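(* For every positive integer $n$ there exist a positive integer $x_1$ and a positive integer $m$ such that for every $i \in \{0,1,\dots,n-1\}$ we have $Col^{i+1}(x_1) > Col^{i}(x_1)$ and the step size of $Col^{i}(x_1)$ equals $m$.
   Context: The Collatz map $Col$ on the positive integers is defined as follows. If $x$ is odd, $Col(x) = (3x+1)/2^{m}$, where $m \ge 1$ is the exponent of the largest power of $2$ dividing $3x+1$; if $x$ is even, $Col(x) = x/2^{m}$, where $m \ge 1$ is the exponent of the largest power of $2$ dividing $x$. In either case this exponent $m$ is called the step size of $x$. $Col^{0}(x) = x$ and $Col^{i+1}(x) = Col(Col^{i}(x))$. *)

(* Defs.v *)
From mathcomp Require Import all_boot.

Set Implicit Arguments.
Unset Strict Implicit.
Unset Printing Implicit Defensive.

(* The maps below are meant on the positive integers; on nat they also take a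
   (meaningless) value at 0, which Col fixes. *)

Definition col_num (x : nat) : nat := if odd x then 3 * x + 1 else x.

(* The exponent of the largest power of 2 dividing col_num x; it is at least 1
   for x > 0 because col_num x is then even and nonzero. *)
Definition step_size (x : nat) : nat := logn 2 (col_num x).

(* The quotient is exact, by the choice of step_size. *)
Definition Col (x : nat) : nat := col_num x %/ 2 ^ step_size x.

(* Main.v *)
Require Import Defs.
From mathcomp Require Import all_boot zify.

(** Take x_1 = 2^(n+1) - 1 and m = 1. If x = 4a - 1 then 3x + 1 = 2(6a - 1) with
    6a - 1 odd, so each step trades one factor 2 of x + 1 for a factor 3. *)

(** After [i] steps the iterate is 3^i 2^(n+1-i) - 1 ([iter_Col_mersenne]). As long as [i < n], at
    least two factors 2 remain, so it is again of the form 4a - 1 and the next step has size 1. *)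

Lemma step_size_4aB1 (a : nat) : 0 < a -> step_size (4 * a - 1) = 1.
Proof.
move=> a_gt0; rewrite /step_size /col_num ifT; last by lia.
have -> : 3 * (4 * a - 1) + 1 = 2 * (6 * a - 1) by lia.
rewrite lognM //; last by lia.
by rewrite (@logn_prime 2 2) // lognE dvdn2 ifF //; lia.
Qed.

Lemma Col_4aB1 (a : nat) : 0 < a -> Col (4 * a - 1) = 6 * a - 1.
Proof.
move=> a_gt0; rewrite /Col step_size_4aB1 // /col_num ifT; last by lia.
have -> : 3 * (4 * a - 1) + 1 = (6 * a - 1) * 2 by lia.
by rewrite expn1 mulnK.
Qed.

Lemma iter_Col_mersenne (n i : nat) :
  i <= n -> iter i Col (2 ^ n.+1 - 1) = 3 ^ i * 2 ^ (n - i).+1 - 1.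
Proof.
elim: i => [|i IHi] lt_in; first by rewrite mul1n subn0.
rewrite iterS IHi; last exact: ltnW.
(* Here [i < n], so a factor 4 splits off and a = 3^i 2^(n-i-1). *)
have -> : n - i = (n - i.+1).+1 by lia.
have -> : 3 ^ i * 2 ^ (n - i.+1).+2 = 4 * (3 ^ i * 2 ^ (n - i.+1)).
  by rewrite !expnS; lia.
rewrite Col_4aB1 ?muln_gt0 ?expn_gt0 // !expnS; lia.
Qed.

Theorem theorem1 (n : nat) (hn : 0 < n) :
  exists x1 m : nat,
    [/\ 0 < x1, 0 < m &
      forall i : nat, i < n ->
        iter i Col x1 < iter i.+1 Col x1 /\ step_size (iter i Col x1) = m].
Proof.
exists (2 ^ n.+1 - 1), 1; split=> // [|i lt_in].
  by rewrite subn_gt0 -{1}(expn0 2) ltn_exp2l.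
rewrite iterS iter_Col_mersenne; last exact: ltnW.
have -> : n - i = (n - i.+1).+1 by lia.
have -> : 3 ^ i * 2 ^ (n - i.+1).+2 = 4 * (3 ^ i * 2 ^ (n - i.+1)).
  by rewrite !expnS; lia.
(* Positivity of a also makes the growth 4a - 1 < 6a - 1 strict. *)
have a_gt0 : 0 < 3 ^ i * 2 ^ (n - i.+1) by rewrite muln_gt0 !expn_gt0.
by rewrite Col_4aB1 // step_size_4aB1 //; split=> //; lia.
Qed.
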